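(* Let $k$ be a field of characteristic not two with algebraic closure $\overline{k}$, and let $m \geq 2$ be an integer. Suppose $\operatorname{Inn}_A$ and $\operatorname{Inn}_B$ are order $m$ automorphisms of $\mathrm{SL}(2,k)$, where $A, B \in \mathrm{SL}(2,k[\sqrt{\alpha}])$ for some $\alpha \in k$ and each entry of $A$ and of $B$ is a $k$-multiple of $\sqrt{\alpha}$. (a) If $A$ and $B$ have the same eigenvalues $\lambda_1$ and $\lambda_2$, then $\operatorname{Inn}_A$ and $\operatorname{Inn}_B$ are isomorphic over $\mathrm{GL}(2,k)$. (b) If $A$ has eigenvalues $\lambda_1$ and $\lambda_2$ and $B$ has eigenvalues $-\lambda_1$ and $-\lambda_2$, then $\operatorname{Inn}_A$ and $\operatorname{Inn}_B$ are isomorphic over $\mathrm{GL}(2,k)$. (c) If $\operatorname{Inn}_A$ is isomorphic to $\operatorname{Inn}_B$ over $\mathrm{GL}(2,k)$, then $A$ has the same eigenvalues as $B$ or $-B$.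
   Context: For $A \in \mathrm{GL}(2,\overline{k})$, $\operatorname{Inn}_A$ denotes the map $X \mapsto A^{-1}XA$. An automorphism of $\mathrm{SL}(2,k)$ means a $k$-automorphism, i.e. an automorphism of the algebraic group $\mathrm{SL}_2$ (equivalently of $\mathrm{SL}(2,\overline{k})$ as an algebraic group) which leaves $\mathrm{SL}(2,k)$ invariant. Two automorphisms $\theta,\tau$ of $\mathrm{SL}(2,k)$ are isomorphic over $\mathrm{GL}(2,k)$ if there is $Q \in \mathrm{GL}(2,k)$ such that $\tau = \operatorname{Inn}_Q^{-1}\,\theta\,\operatorname{Inn}_Q$. A $k$-multiple of $\sqrt{\alpha}$ is an element $t\sqrt{\alpha}$ with $t\in k$, where $\sqrt{\alpha}\in\overline{k}$ is a fixed square root of $\alpha$. Eigenvalues are taken in $\overline{k}$, with multiplicity. *)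

(* Defs.v *)
From mathcomp Require Import all_boot all_order all_algebra.
From mathcomp Require Import mpoly.
Set Implicit Arguments.
Unset Strict Implicit.
Unset Printing Implicit Defensive.
Import GRing.Theory.
Local Open Scope ring_scope.

(* A subring of K is given as a Prop-valued predicate [S]. *)
Definition SL2 (K : comNzRingType) (S : K -> Prop) (X : 'M[K]_2) : Prop :=
  \det X = 1 /\ forall i j, S (X i j).

Definition allof (K : nzRingType) : K -> Prop := fun _ => True.

Section Extension.
Variables (k : fieldType) (K : closedFieldType) (iota : {rmorphism k -> K}).

Definition is_algebraic_closure : Prop :=
  forall x : K, algebraicOver iota x.

Definition base (x : K) : Prop := exists t : k, x = iota t.

Definition k_multiple (s x : K) : Prop := exists t : k, x = iota t * s.

(* k[s] when s ^+ 2 lies in k *)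
Definition base_adjoin_sqrt (s x : K) : Prop :=
  exists t u : k, x = iota t + iota u * s.

End Extension.

(* Maps of SL_2 are represented by functions on all of 'M_2; only their values
   on SL(2,K) are relevant, hence the following equality. *)
Definition eq_on_SL2 (K : comNzRingType) (f g : 'M[K]_2 -> 'M[K]_2) : Prop :=
  forall X, SL2 (@allof K) X -> f X = g X.

Definition Inn (K : fieldType) (A X : 'M[K]_2) : 'M[K]_2 :=
  invmx A *m X *m A.

Lemma InnK (K : fieldType) (A : 'M[K]_2) :
  A \in unitmx -> cancel (Inn A) (Inn (invmx A)).
Proof.
by move=> uA X; rewrite /Inn invmxK !mulmxA mulmxV // mul1mx mulmxK.
Qed.

Lemma InnVK (K : fieldType) (A : 'M[K]_2) :
  A \in unitmx -> cancel (Inn (invmx A)) (Inn A).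
Proof.
by move=> uA X; rewrite /Inn invmxK !mulmxA mulVmx // mul1mx mulmxKV.
Qed.

(* Each entry of f X is a polynomial in the four entries of X, for X in SL_2. *)
Definition regular_on_SL2 (K : comNzRingType) (f : 'M[K]_2 -> 'M[K]_2) : Prop :=
  forall i j, exists p : {mpoly K[2 * 2]},
    forall X, SL2 (@allof K) X -> f X i j = p.@[fun l => mxvec X 0 l].

Definition algebraic_endo (K : comNzRingType) (f : 'M[K]_2 -> 'M[K]_2) : Prop :=
  [/\ forall X, SL2 (@allof K) X -> SL2 (@allof K) (f X),
      forall X Y, SL2 (@allof K) X -> SL2 (@allof K) Y ->
        f (X *m Y) = f X *m f Y
    & regular_on_SL2 f].

Definition algebraic_auto (K : comNzRingType) (f : 'M[K]_2 -> 'M[K]_2) : Prop :=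
  algebraic_endo f /\
  exists g, [/\ algebraic_endo g, eq_on_SL2 (g \o f) id
              & eq_on_SL2 (f \o g) id].

Definition has_order (K : comNzRingType) (f : 'M[K]_2 -> 'M[K]_2) (m : nat) :
    Prop :=
  [/\ (0 < m)%N, eq_on_SL2 (iter m f) id
    & forall n, (0 < n < m)%N -> ~ eq_on_SL2 (iter n f) id].

Section Automorphisms.
Variables (k : fieldType) (K : closedFieldType) (iota : {rmorphism k -> K}).

(* The last clause says f (SL(2,k)) = SL(2,k). *)
Definition k_automorphism (f : 'M[K]_2 -> 'M[K]_2) : Prop :=
  algebraic_auto f /\
  forall Y, SL2 (base iota) Y <-> exists2 X, SL2 (base iota) X & f X = Y.

(* By InnK and InnVK, Inn (invmx Q) is the inverse of Inn Q. *)
Definition isomorphic_over_GL2 (theta tau : 'M[K]_2 -> 'M[K]_2) : Prop :=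
  exists2 Q0 : 'M[k]_2, Q0 \in unitmx &
    let Q := map_mx iota Q0 in
    eq_on_SL2 tau (Inn (invmx Q) \o theta \o Inn Q).

End Automorphisms.

(* Eigenvalues with algebraic multiplicity, as an unordered pair. *)
Definition has_eigenvalues (K : fieldType) (A : 'M[K]_2) (l1 l2 : K) : Prop :=
  char_poly A = ('X - l1%:P) * ('X - l2%:P).

Definition same_eigenvalues (K : fieldType) (A B : 'M[K]_2) : Prop :=
  exists l1 l2, has_eigenvalues A l1 l2 /\ has_eigenvalues B l1 l2.

(* Main.v *)
Require Import Defs.
From mathcomp Require Import all_boot all_order all_algebra.
From mathcomp Require Import ring.
Import GRing.Theory.
Local Open Scope ring_scope.

(** Write [A = s *: A0] and [B = s *: B0] with [A0], [B0] over [k].  Neither is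
    scalar, because the order [m] is at least 2.  A non-scalar 2x2 matrix has a
    cyclic vector, so over [k] it is conjugate to the companion matrix of its
    characteristic polynomial; this gives (a), and (b) follows since
    [Inn (- B) = Inn B].  For (c), [Inn B = Inn (Q A Q^-1)] on SL_2 forces
    [B = c Q A Q^-1] for a scalar [c], and [c ^+ 2 = 1] by taking
    determinants. *)

(** The companion matrix of X^2 - t X + d in the convention for row vectors: multiplied on the right
    by a matrix with rows v and v A, it yields the rows v A and t (v A) - d v. *)
Definition companion2 {F : fieldType} (t d : F) : 'M[F]_2 :=
  \matrix_(i, j) if i == 0 then (j == 1)%:R else if j == 0 then - d else t.

Lemma forall_ord2 (P : 'I_2 -> Prop) : P 0 -> P 1 -> forall i, P i.
Proof.
move=> P0 P1; case=> [[|[|//]] lti].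
- by rewrite (_ : Ordinal lti = 0) //; apply: val_inj.
- by rewrite (_ : Ordinal lti = 1) //; apply: val_inj.
Qed.

Lemma matrix2P (R : Type) (A B : 'M[R]_2) :
  A 0 0 = B 0 0 -> A 0 1 = B 0 1 -> A 1 0 = B 1 0 -> A 1 1 = B 1 1 -> A = B.
Proof. by move=> *; apply/matrixP; do 2! [apply: forall_ord2]. Qed.

Lemma sum_ord2 (V : nmodType) (f : 'I_2 -> V) : \sum_(i < 2) f i = f 0 + f 1.
Proof. by rewrite big_ord_recl big_ord1; congr (_ + f _); apply: val_inj. Qed.

Lemma mulmx2E (R : nzRingType) (A B : 'M[R]_2) i j :
  (A *m B) i j = A i 0 * B 0 j + A i 1 * B 1 j.
Proof. by rewrite mxE sum_ord2. Qed.

Lemma det_mx22 (R : comNzRingType) (A : 'M[R]_2) :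
  \det A = A 0 0 * A 1 1 - A 0 1 * A 1 0.
Proof.
rewrite (expand_det_row A 0) sum_ord2 /cofactor !det_mx11 !mxE /=.
have -> : lift 0 0 = 1 :> 'I_2 by apply: val_inj.
have -> : lift 1 0 = 0 :> 'I_2 by apply: val_inj.
by ring.
Qed.

Lemma char_poly2 (R : comNzRingType) (A : 'M[R]_2) :
  char_poly A = 'X^2 - (\tr A) *: 'X + (\det A)%:P.
Proof.
rewrite /char_poly /mxtrace sum_ord2 !det_mx22 !mxE /= -mul_polyC.
by rewrite !(rmorphB, rmorphD, rmorphM) /=; ring.
Qed.

(** Trades eigenvalues, which live in the closure, for trace and determinant, which descend to the
    base field once powers of the square root are divided out. *)
Lemma has_eigenvaluesE {F : fieldType} (A : 'M[F]_2) (l1 l2 : F) :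
  has_eigenvalues A l1 l2 <-> \tr A = l1 + l2 /\ \det A = l1 * l2.
Proof.
rewrite /has_eigenvalues char_poly2.
have -> : ('X - l1%:P) * ('X - l2%:P) = 'X^2 - (l1 + l2) *: 'X + (l1 * l2)%:P.
  by rewrite -mul_polyC !(rmorphD, rmorphM) /=; ring.
split=> [/polyP eqp|[-> ->] //].
have := (eqp 0%N, eqp 1%N).
rewrite !(coefD, coefN, coefZ, coefXn, coefX, coefC) /=.
rewrite !(mulr0, mulr1, addr0, add0r, oppr0).
by case=> -> /oppr_inj ->.
Qed.

(** Take [P] with rows v and v A, where v = (x, y); the intertwining relation is then
    Cayley-Hamilton applied to v. The determinant of [P] is a quadratic form in x and y whose
    coefficients all vanish only if [A] is scalar, so some v is cyclic. *)
Lemma nonscalar_similar_companion2 {F : fieldType} (A : 'M[F]_2) :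
  ~~ is_scalar_mx A ->
  exists2 P : 'M[F]_2, P \in unitmx & P *m A = companion2 (\tr A) (\det A) *m P.
Proof.
move=> nsA.
pose P x y : 'M[F]_2 := \matrix_(i, j)
  if i == 0 then (if j == 0 then x else y) else x * A 0 j + y * A 1 j.
have PA x y : P x y *m A = companion2 (\tr A) (\det A) *m P x y.
  rewrite /mxtrace sum_ord2 det_mx22.
  by apply: matrix2P; rewrite !mulmx2E !mxE /=; ring.
suff [x [y Pn0]] : exists x y, \det (P x y) != 0.
  by exists (P x y); rewrite ?PA // unitmxE unitfE.
have detP x y : \det (P x y) =
    A 0 1 * x ^+ 2 + (A 1 1 - A 0 0) * (x * y) - A 1 0 * y ^+ 2.
  by rewrite det_mx22 !mxE /=; ring.
have [b0|bn0] := eqVneq (A 0 1) 0; last first.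
  by exists 1, 0; rewrite detP (_ : _ - _ = A 0 1) //; ring.
have [c0|cn0] := eqVneq (A 1 0) 0; last first.
  by exists 0, 1; rewrite detP (_ : _ - _ = - A 1 0) ?oppr_eq0 //; ring.
(* For diagonal [A] only the cross term of the form survives, and its coefficient is the difference
   of the diagonal entries. *)
exists 1, 1; rewrite detP b0 c0 (_ : _ - _ = A 1 1 - A 0 0); last by ring.
rewrite subr_eq0; apply: contraNneq nsA => da.
apply/is_scalar_mxP; exists (A 0 0).
by apply: matrix2P; rewrite !mxE /= ?b0 ?c0.
Qed.

Lemma nonscalar_similar2 {F : fieldType} (A B : 'M[F]_2) :
  ~~ is_scalar_mx A -> ~~ is_scalar_mx B -> \tr A = \tr B -> \det A = \det B ->
  exists2 Q : 'M[F]_2, Q \in unitmx & B *m Q = Q *m A.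
Proof.
move=> /nonscalar_similar_companion2 [P uP PA].
move=> /nonscalar_similar_companion2 [R uR RB] trAB detAB.
(* [P] leads from [A] to the common companion matrix, and the inverse of [R] leads from there to
   [B]. *)
exists (invmx R *m P); first by rewrite unitmx_mul unitmx_inv uR.
apply: (can_inj (mulKmx uR)); rewrite !mulmxA RB mulmxV // mul1mx.
by rewrite PA trAB detAB mulmxK.
Qed.

Lemma InnM (K : fieldType) (A B X : 'M[K]_2) :
  A \in unitmx -> B \in unitmx -> Inn B (Inn A X) = Inn (A *m B) X.
Proof.
move=> uA uB; rewrite /Inn !mulmxA; congr (_ *m _ *m _ *m _).
have uAB : A *m B \in unitmx by rewrite unitmx_mul uA.
by apply: (can_inj (mulKmx uAB)); rewrite mulmxV // mulmxA mulmxK // mulmxV.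
Qed.

Lemma InnZ (K : fieldType) (c : K) (A X : 'M[K]_2) :
  c != 0 -> A \in unitmx -> Inn (c *: A) X = Inn A X.
Proof.
move=> cn0 uA; rewrite /Inn invmxZ ?unitmxZ ?unitfE //.
by rewrite -!scalemxAl -scalemxAr scalerA mulVf // scale1r.
Qed.

Lemma det1_unitmx {K : fieldType} {n} {A : 'M[K]_n} :
  \det A = 1 -> A \in unitmx.
Proof. by rewrite unitmxE => ->; apply: unitr1. Qed.

(** Two unipotents suffice. Commuting with the upper one, [U], kills the lower left entry of [Z] and
    equates its diagonal entries; commuting with the lower one, [L], kills the upper right entry. *)
Lemma centralizer_SL2_scalar (K : fieldType) (Z : 'M[K]_2) :
  (forall X, SL2 (@allof K) X -> Z *m X = X *m Z) -> is_scalar_mx Z.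
Proof.
move=> cZ.
pose U : 'M[K]_2 := \matrix_(i, j) ((i == j) || (j == 1))%:R.
pose L : 'M[K]_2 := \matrix_(i, j) ((i == j) || (j == 0))%:R.
have /cZ/matrixP ZU : SL2 (@allof K) U.
  by split=> //; rewrite det_mx22 !mxE /=; ring.
have /cZ/matrixP ZL : SL2 (@allof K) L.
  by split=> //; rewrite det_mx22 !mxE /=; ring.
have := (ZU 0 0, ZU 0 1, ZL 0 0).
rewrite !mulmx2E !mxE /= !(mulr1, mulr0, mul1r, mul0r, addr0).
case=> [[/esym/eqP]]; rewrite addrC -subr_eq0 addrK => /eqP c0.
rewrite [Z 0 1 + _]addrC => /addIr da /esym/eqP.
rewrite eq_sym addrC -subr_eq0 addrK => /eqP b0.
apply/is_scalar_mxP; exists (Z 0 0).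
by apply: matrix2P; rewrite !mxE /= ?b0 ?c0.
Qed.

Lemma eq_Inn_det1 (K : fieldType) (A B : 'M[K]_2) :
  \det A = 1 -> \det B = 1 -> eq_on_SL2 (Inn A) (Inn B) -> B = A \/ B = - A.
Proof.
move=> dA dB eqAB; have uA := det1_unitmx dA; have uB := det1_unitmx dB.
(* Equality of the two conjugations at X says exactly that B A^-1 commutes with X. *)
have /is_scalar_mxP[c defc] : is_scalar_mx (B *m invmx A).
  apply: centralizer_SL2_scalar => X /eqAB.
  move=> /(congr1 (fun Y => B *m Y *m invmx A)).
  by rewrite /Inn !mulmxA mulmxV // mul1mx mulmxK.
have defB : B = c *: A by rewrite -mul_scalar_mx -defc mulmxKV.
have := dB; rewrite defB detZ dA mulr1 => /eqP; rewrite sqrf_eq1.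
by case/orP=> /eqP ->; [left; rewrite scale1r | right; rewrite scaleN1r].
Qed.

(** Over the polynomial ring (X - B) Q = Q (X - A); take determinants and cancel det Q, a nonzero
    constant. *)
Lemma char_poly_similar {F : fieldType} {n} {A B Q : 'M[F]_n} :
  Q \in unitmx -> B *m Q = Q *m A -> char_poly B = char_poly A.
Proof.
move=> uQ BQ; pose Qp := map_mx polyC Q.
have dQ : \det Qp != 0.
  by rewrite det_map_mx polyC_eq0 -unitfE -unitmxE.
apply: (mulIf dQ); rewrite [RHS]mulrC -!det_mulmx; congr (\det _).
by rewrite mulmxBl mulmxBr -!map_mxM BQ scalar_mxC.
Qed.

Lemma closed_has_eigenvalues {K : closedFieldType} (A : 'M[K]_2) :
  exists l1 l2, has_eigenvalues A l1 l2.
Proof.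
have [r defr] := closed_field_poly_normal (char_poly A).
have := size_char_poly A.
rewrite defr (monicP (char_poly_monic A)) scale1r size_prod_XsubC => -[szr].
case: r szr defr => [|l1 [|l2 [|]]] //= _.
rewrite (monicP (char_poly_monic A)) scale1r !big_cons big_nil mulr1 => ?.
by exists l1, l2.
Qed.

(** Conjugation by a scalar matrix is the identity, which the minimality clause of [has_order]
    forbids at exponent 1 < m. *)
Lemma order_ge2_nonscalar {K : fieldType} {A : 'M[K]_2} {m} :
  A \in unitmx -> (2 <= m)%N -> has_order (Inn A) m -> ~~ is_scalar_mx A.
Proof.
move=> uA m_ge2 [_ _ /(_ 1%N) ord1]; apply/negP => /is_scalar_mxP[c defA].
apply: ord1 => // X _; rewrite /= /Inn -[RHS](mulKmx uA) -mulmxA.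
by congr (_ *m _); rewrite defA scalar_mxC.
Qed.

Lemma oppmx_is_scalar (R : pzRingType) n (A : 'M[R]_n) :
  is_scalar_mx (- A) = is_scalar_mx A.
Proof.
by apply/is_scalar_mxP/is_scalar_mxP=> -[c /(congr1 -%R) eA]; exists (- c);
  rewrite ?raddfN // -eA opprK.
Qed.

Lemma entries_k_multiple (k : fieldType) (K : closedFieldType)
    (iota : {rmorphism k -> K}) (s : K) (A : 'M[K]_2) :
  (forall i j, k_multiple iota s (A i j)) ->
  exists A0 : 'M[k]_2, A = s *: map_mx iota A0.
Proof.
move=> kA.
have [f fE] := fin_all_exists (fun i => fin_all_exists (kA i)).
by exists (\matrix_(i, j) f i j); apply/matrixP=> i j; rewrite !mxE mulrC fE.
Qed.

Lemma similar_over_base {k : fieldType} {K : closedFieldType}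
    {iota : {rmorphism k -> K}} {s : K} {A B : 'M[K]_2} {l1 l2 : K} :
  (forall i j, k_multiple iota s (A i j)) ->
  (forall i j, k_multiple iota s (B i j)) ->
  ~~ is_scalar_mx A -> ~~ is_scalar_mx B ->
  has_eigenvalues A l1 l2 -> has_eigenvalues B l1 l2 ->
  exists2 Q : 'M[k]_2, Q \in unitmx & B *m map_mx iota Q = map_mx iota Q *m A.
Proof.
move=> /entries_k_multiple[A0 ->] /entries_k_multiple[B0 ->].
have nonscalar0 (C : 'M_2) :
    ~~ is_scalar_mx (s *: map_mx iota C) -> ~~ is_scalar_mx C.
  apply: contra => /is_scalar_mxP[c ->]; apply/is_scalar_mxP.
  by exists (s * iota c); rewrite map_scalar_mx scale_scalar_mx.
move=> nsA nsB /has_eigenvaluesE[trA dA] /has_eigenvaluesE[trB dB].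
(* If [s] were zero, [A] would be the zero matrix, which is scalar. Hence [s] and its square can be
   cancelled from the equalities of traces and determinants below. *)
have s_neq0 : s != 0.
  apply: contraNneq nsA => ->; apply/is_scalar_mxP; exists 0.
  by rewrite scale0r raddf0.
have [||||Q uQ BQ] := @nonscalar_similar2 k A0 B0.
- exact: nonscalar0.
- exact: nonscalar0.
- apply: (fmorph_inj iota); apply: (mulfI s_neq0).
  by rewrite -!trace_map_mx -!mxtraceZ trA.
- apply: (fmorph_inj iota); apply: (mulfI (expf_neq0 2 s_neq0)).
  by rewrite -!det_map_mx -!detZ dA.
by exists Q => //; rewrite -scalemxAl -scalemxAr -!map_mxM BQ.
Qed.

(** The conjugated map is itself inner, given by Q A Q^-1 of determinant 1, so [eq_Inn_det1]
    determines this matrix from [B] up to sign. Conversely, [Inn] does not see the sign. *)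
Lemma isomorphic_InnE (k : fieldType) (K : closedFieldType)
    (iota : {rmorphism k -> K}) (A B : 'M[K]_2) :
  \det A = 1 -> \det B = 1 ->
  isomorphic_over_GL2 iota (Inn A) (Inn B) <->
  exists2 Q : 'M[k]_2, Q \in unitmx &
    B *m map_mx iota Q = map_mx iota Q *m A \/
    - B *m map_mx iota Q = map_mx iota Q *m A.
Proof.
move=> dA dB; have uA := det1_unitmx dA; have uB := det1_unitmx dB.
have conjE (Q : 'M_2) X : Q \in unitmx ->
    Inn (invmx Q) (Inn A (Inn Q X)) = Inn (Q *m A *m invmx Q) X.
  by move=> uQ; rewrite !InnM ?mulmxA ?unitmx_mul ?unitmx_inv ?uQ ?uA.
split=> [] [Q0 uQ0 H]; exists Q0 => //; move: H; set Q := map_mx iota Q0 => H.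
  have uQ : Q \in unitmx by rewrite map_unitmx.
  have [|X hX|<-|eB] := @eq_Inn_det1 K B (Q *m A *m invmx Q) dB.
  - by rewrite !det_mulmx dA mulr1 -det_mulmx mulmxV ?det1.
  - by rewrite H /= ?conjE.
  - by left; rewrite mulmxKV.
  - by right; rewrite -eB mulmxKV.
have uQ : Q \in unitmx by rewrite map_unitmx.
move=> /= X _; rewrite [RHS]conjE //.
by case: H => <-; rewrite mulmxK // -scaleN1r InnZ // oppr_eq0 oner_eq0.
Qed.

Theorem theorem4p3
  (k : fieldType) (hchar : 2%N \notin [pchar k])
  (kbar : closedFieldType) (iota : {rmorphism k -> kbar})
  (hkbar : is_algebraic_closure iota)
  (m : nat) (hm : (2 <= m)%N)
  (alpha : k) (sqrt_alpha : kbar) (hsqrt : sqrt_alpha ^+ 2 = iota alpha)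
  (A B : 'M[kbar]_2)
  (hA : SL2 (base_adjoin_sqrt iota sqrt_alpha) A)
  (hB : SL2 (base_adjoin_sqrt iota sqrt_alpha) B)
  (hAentries : forall i j, k_multiple iota sqrt_alpha (A i j))
  (hBentries : forall i j, k_multiple iota sqrt_alpha (B i j))
  (hInnA : k_automorphism iota (Inn A)) (hordA : has_order (Inn A) m)
  (hInnB : k_automorphism iota (Inn B)) (hordB : has_order (Inn B) m) :
  [/\ (forall l1 l2 : kbar,
         has_eigenvalues A l1 l2 -> has_eigenvalues B l1 l2 ->
         isomorphic_over_GL2 iota (Inn A) (Inn B)),
      (forall l1 l2 : kbar,
         has_eigenvalues A l1 l2 -> has_eigenvalues B (- l1) (- l2) ->
         isomorphic_over_GL2 iota (Inn A) (Inn B))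
    & (isomorphic_over_GL2 iota (Inn A) (Inn B) ->
       same_eigenvalues A B \/ same_eigenvalues A (- B))].
Proof.
have dA := hA.1; have dB := hB.1.
have nsA := order_ge2_nonscalar (det1_unitmx dA) hm hordA.
have nsB := order_ge2_nonscalar (det1_unitmx dB) hm hordB.
split.
- move=> l1 l2 eA eB; apply/isomorphic_InnE => //.
  have [Q uQ BQ] := similar_over_base hAentries hBentries nsA nsB eA eB.
  by exists Q; last left.
- move=> l1 l2 eA /has_eigenvaluesE[trB detB]; apply/isomorphic_InnE => //.
  (* The argument of the first part is run on [- B], which has eigenvalues [l1] and [l2]; the sign
     is absorbed by the second alternative of [isomorphic_InnE]. *)
  have hNB i j : k_multiple iota sqrt_alpha ((- B) i j).
    have [t Bij] := hBentries i j.
    by exists (- t); rewrite mxE Bij rmorphN mulNr.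
  have eNB : has_eigenvalues (- B) l1 l2.
    apply/has_eigenvaluesE; rewrite raddfN /= trB -opprD opprK; split=> //.
    by rewrite -scaleN1r detZ sqrrN expr1n mul1r detB mulrNN.
  have nsNB : ~~ is_scalar_mx (- B) by rewrite oppmx_is_scalar.
  have [Q uQ BQ] := similar_over_base hAentries hNB nsA nsNB eA eNB.
  by exists Q; last right.
- case/isomorphic_InnE => // Q uQ BQ.
  (* The characteristic polynomial of [A] splits over [kbar], and similarity transfers this
     factorization to [B] or [- B]. *)
  have [l1 [l2 eA]] := closed_has_eigenvalues A.
  have uQi : map_mx iota Q \in unitmx by rewrite map_unitmx.
  by case: BQ => BQ; [left | right]; exists l1, l2; split=> //;
    rewrite /has_eigenvalues (char_poly_similar uQi BQ).
Qed.
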